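(* There is a universal constant $C$ such that the following holds. For $j\in\{1,2\}$ let $A^1_j,\dots,A^n_j,B_j\in\mathrm{Sym}_k$, where $A^i_1\succeq0$ and $A^i_2\preceq 0$ for all $i$. Let $F:\{-1,1\}^n\to\{0,1\}$, $F(x)=\bigwedge_{j=1}^2\big[\sum_i x_iA^i_j\preceq B_j\big]$. Then $\mathsf{AS}(F)\le C\sqrt n$.
   Context: $\mathrm{Sym}_k$: real symmetric $k\times k$ matrices; $\preceq$: Löwner order. The average sensitivity of $F:\{-1,1\}^n\to\{0,1\}$ is $\mathsf{AS}(F)=\sum_{i=1}^n\Pr_{\boldsymbol{x}}[F(\boldsymbol{x})\ne F(\boldsymbol{x}^{(i)})]$ with $\boldsymbol{x}$ uniform and $\boldsymbol{x}^{(i)}$ obtained by flipping coordinate $i$. *)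

(* Defs.v *)
From mathcomp Require Import all_boot all_order all_algebra.
From mathcomp Require Import boolp reals.

Set Implicit Arguments.
Unset Strict Implicit.
Unset Printing Implicit Defensive.

Import Order.TTheory GRing.Theory Num.Theory.
Local Open Scope ring_scope.

(* The cube {-1,1}^n is encoded by bits: x stands for the sign vector with
   i-th coordinate (-1)^(x i). *)
Definition cube (n : nat) : finType := {ffun 'I_n -> bool}.

Definition cube_sign (R : pzRingType) (n : nat) (x : cube n) (i : 'I_n) : R :=
  (-1) ^+ x i.

Definition cube_flip (n : nat) (i : 'I_n) (x : cube n) : cube n :=
  [ffun l => if l == i then ~~ x l else x l].

Definition uniform_prob (R : fieldType) (n : nat) (E : pred (cube n)) : R :=
  #|[set x | E x]|%:R / #|cube n|%:R.

Definition avg_sens (R : fieldType) (n : nat) (F : cube n -> bool) : R :=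
  \sum_(i < n) uniform_prob R (fun x => F x != F (cube_flip i x)).

Definition psd (R : realFieldType) (k : nat) (M : 'M[R]_k) : Prop :=
  M \is symmetricmx /\ forall v : 'cV[R]_k, 0 <= (v^T *m M *m v) ord0 ord0.

Definition loewner_le (R : realFieldType) (k : nat) (M N : 'M[R]_k) : Prop :=
  psd (N - M).

Definition matrix_halfspace (R : realType) (n k : nat)
    (A : 'I_n -> 'M[R]_k) (B : 'M[R]_k) (x : cube n) : bool :=
  `[< loewner_le (\sum_(i < n) cube_sign R x i *: A i) B >].

(* Main.v *)
Require Import Defs.
From mathcomp Require Import all_boot all_order all_algebra.
From mathcomp Require Import boolp reals.
From mathcomp Require Import ring.

Set Implicit Arguments.
Unset Strict Implicit.
Unset Printing Implicit Defensive.

Import Order.TTheory GRing.Theory Num.Theory.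
Local Open Scope ring_scope.

(** A halfspace whose coefficients are each positive or negative semidefinite is
    unate: it is antitone in every [s_i x_i], where the sign [s_i] makes
    [s_i A_i] positive semidefinite. For a unate [F] the influence of the
    coordinate [i] is the Fourier coefficient [E[s_i x_i (-1)^F(x)]], so the
    average sensitivity is [E[(-1)^F(x) sum_i s_i x_i]], at most the L2 norm
    [sqrt n] of [sum_i s_i x_i]. A coordinate sensitive for the conjunction is
    sensitive for one of the two factors, which gives the constant [C = 2]. *)

Section CubeFlip.
Variable n : nat.
Implicit Types (x : cube n) (i j : 'I_n).

Lemma cube_flipK i : involutive (@cube_flip n i).
Proof.
move=> x; apply/ffunP => j; rewrite !ffunE.
by case: eqP => // _; rewrite negbK.
Qed.

Lemma cube_sign_flip (R : pzRingType) i x j :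
  cube_sign R (cube_flip i x) j = (-1) ^+ (j == i) * cube_sign R x j.
Proof.
by rewrite /cube_sign ffunE -signr_addb; case: (j == i); case: (x j).
Qed.

Lemma sqr_cube_sign (R : pzRingType) x i : cube_sign R x i ^+ 2 = 1.
Proof. exact: sqrr_sign. Qed.

End CubeFlip.

Definition cube_mean (R : fieldType) (n : nat) (f : cube n -> R) : R :=
  (\sum_x f x) / #|cube n|%:R.

Section CubeMean.
Variables (R : fieldType) (n : nat).
Implicit Types (f g : cube n -> R).

Lemma eq_cube_mean f g : f =1 g -> cube_mean f = cube_mean g.
Proof. by move=> eq_fg; congr (_ / _); apply: eq_bigr. Qed.

Lemma cube_meanD f g :
  cube_mean (fun x => f x + g x) = cube_mean f + cube_mean g.
Proof. by rewrite /cube_mean big_split mulrDl. Qed.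

Lemma cube_meanZ a f : cube_mean (fun x => a * f x) = a * cube_mean f.
Proof. by rewrite /cube_mean -mulr_sumr mulrA. Qed.

Lemma cube_mean_sum (I : finType) (f : I -> cube n -> R) :
  cube_mean (fun x => \sum_i f i x) = \sum_i cube_mean (f i).
Proof. by rewrite /cube_mean exchange_big mulr_suml. Qed.

Lemma cube_mean_flip i f : cube_mean (fun x => f (cube_flip i x)) = cube_mean f.
Proof.
by congr (_ / _); rewrite [RHS](reindex_inj (inv_inj (@cube_flipK n i))).
Qed.

Lemma uniform_probE (E : pred (cube n)) :
  uniform_prob R E = cube_mean (fun x => (E x)%:R).
Proof.
congr (_ / _); rewrite -sum1dep_card natr_sum big_mkcond.
by apply: eq_bigr => x _; case: (E x).
Qed.

End CubeMean.

Section CubeMeanNum.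
Variables (R : numFieldType) (n : nat).
Implicit Types (f g : cube n -> R) (i j : 'I_n).

Lemma cube_mean_cst (c : R) : cube_mean (fun _ : cube n => c) = c.
Proof.
rewrite /cube_mean sumr_const -[c *+ _]mulr_natr mulfK // pnatr_eq0 -lt0n.
by apply/card_gt0P; exists [ffun=> false].
Qed.

Lemma le_cube_mean f g :
  (forall x, f x <= g x) -> cube_mean f <= cube_mean g.
Proof.
by move=> le_fg; rewrite ler_wpM2r ?invr_ge0 ?ler0n //; apply: ler_sum.
Qed.

Lemma cube_mean_signM i j :
  cube_mean (fun x => cube_sign R x i * cube_sign R x j) = (i == j)%:R.
Proof.
have [->|neq_ij] := eqVneq i j.
  by under eq_cube_mean do rewrite -expr2 sqr_cube_sign; rewrite cube_mean_cst.
apply/eqP; rewrite -eqNr -[eqbRHS](cube_mean_flip i) -mulN1r -cube_meanZ.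
apply/eqP/eq_cube_mean => x; rewrite !cube_sign_flip eqxx eq_sym.
by rewrite (negPf neq_ij) mul1r mulrA.
Qed.

Lemma cube_mean_sqr_linear_form (a : 'I_n -> R) :
  cube_mean (fun x => (\sum_i a i * cube_sign R x i) ^+ 2) = \sum_i a i ^+ 2.
Proof.
under eq_cube_mean do rewrite expr2 big_distrlr /=.
rewrite cube_mean_sum; apply: eq_bigr => i _; rewrite cube_mean_sum.
rewrite (eq_bigr (fun j => a i * a j * (i == j)%:R)) => [|j _]; last first.
  by under eq_cube_mean do rewrite mulrACA; rewrite cube_meanZ cube_mean_signM.
rewrite (bigD1 i) //= eqxx mulr1 big1 ?addr0 // => j.
by rewrite eq_sym => /negPf ->; rewrite mulr0.
Qed.

End CubeMeanNum.

Lemma sqr_cube_mean_le (R : realFieldType) n (f : cube n -> R) :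
  cube_mean f ^+ 2 <= cube_mean (fun x => f x ^+ 2).
Proof.
set m := cube_mean f; rewrite -subr_ge0.
have <- : cube_mean (fun x => (f x - m) ^+ 2) =
    cube_mean (fun x => f x ^+ 2) - m ^+ 2.
  have sqrB x : (f x - m) ^+ 2 = f x ^+ 2 + (- 2 * m * f x + m ^+ 2) by ring.
  under eq_cube_mean do rewrite sqrB.
  by rewrite !cube_meanD cube_meanZ cube_mean_cst -/m; ring.
rewrite -[leLHS](@cube_mean_cst R n); apply: le_cube_mean => x.
exact: sqr_ge0.
Qed.

Lemma cube_mean_le_sqrt (R : rcfType) n (f : cube n -> R) :
  cube_mean f <= Num.sqrt (cube_mean (fun x => f x ^+ 2)).
Proof.
apply: le_trans (ler_norm _) _.
by rewrite -sqrtr_sqr ler_wsqrtr ?sqr_cube_mean_le.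
Qed.

Definition influence (R : fieldType) n (F : cube n -> bool) (i : 'I_n) : R :=
  uniform_prob R (fun x => F x != F (cube_flip i x)).

(* With signs [s_i = (-1)^(s i)] and [x_i = (-1)^(x i)]: [F] is antitone in each
   product [s_i x_i], as the hypothesis [x i = s i] says that it equals [1]. *)
Definition unate n (s : cube n) (F : cube n -> bool) :=
  forall i (x : cube n), x i = s i -> F x -> F (cube_flip i x).

Section AverageSensitivity.
Variable n : nat.
Implicit Types (s x : cube n) (F : cube n -> bool) (i : 'I_n).

Lemma avg_sensE (R : fieldType) F : avg_sens R F = \sum_i influence R F i.
Proof. by []. Qed.

Lemma avg_sens_op2_le (R : numFieldType) (op : bool -> bool -> bool) F1 F2 :
  avg_sens R (fun x => op (F1 x) (F2 x)) <= avg_sens R F1 + avg_sens R F2.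
Proof.
rewrite !avg_sensE -big_split; apply: ler_sum => i _ /=.
rewrite /influence !uniform_probE -cube_meanD; apply: le_cube_mean => x.
rewrite -natrD ler_nat.
have [->|_] := eqVneq (F1 x) (F1 _); last exact: leq_trans (leq_b1 _) _.
by have [->|_] := eqVneq (F2 x) (F2 _); rewrite ?eqxx ?leq_b1.
Qed.

Lemma unate_sensitive s F i x :
  unate s F -> F x != F (cube_flip i x) -> F x = s i (+) x i.
Proof.
move=> unateF neqF; have [eq_xs|neq_xs] := eqVneq (x i) (s i).
  rewrite eq_xs addbb; apply: contraNF neqF => Fx.
  by rewrite Fx (unateF _ _ eq_xs Fx).
have -> : s i (+) x i by rewrite addbC -negb_eqb.
apply: contraNT neqF => nFx; rewrite (negPf nFx) eq_sym eqbF_neg.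
apply: contra nFx => /unateF; rewrite -[in F x](cube_flipK i x); apply.
by rewrite ffunE eqxx; case: (x i) (s i) neq_xs => [] [].
Qed.

Lemma sensitivity_unate (R : pzRingType) s F i x : unate s F ->
  let f y := cube_sign R s i * cube_sign R y i * (-1) ^+ F y in
  (F x != F (cube_flip i x))%:R *+ 2 = f x + f (cube_flip i x).
Proof.
move=> unateF; rewrite /= cube_sign_flip eqxx mulN1r mulrN mulNr -mulrBr.
have [->|neqF] := eqVneq (F x) (F _); first by rewrite subrr mulr0 mul0rn.
rewrite -signr_addb -(unate_sensitive unateF neqF).
have <- : ~~ F x = F (cube_flip i x) by apply/addbP; rewrite -negb_eqb.
by rewrite signrN opprK -mulr2n mulrnAr -expr2 sqrr_sign.
Qed.

Lemma influence_unate (R : numFieldType) s F i : unate s F ->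
  influence R F i =
  cube_mean (fun x => cube_sign R s i * cube_sign R x i * (-1) ^+ F x).
Proof.
move=> unateF; set f := fun x => _; apply: (@pmulrnI _ 2) => //.
rewrite [RHS]mulr2n -{2}(cube_mean_flip i f) -cube_meanD.
rewrite -[LHS]mulr_natl /influence uniform_probE -cube_meanZ.
by apply: eq_cube_mean => x; rewrite mulr_natl (sensitivity_unate _ _ _ unateF).
Qed.

Lemma avg_sens_unate (R : rcfType) s F :
  unate s F -> avg_sens R F <= Num.sqrt n%:R.
Proof.
move=> unateF; rewrite avg_sensE.
under eq_bigr => i _ do rewrite (influence_unate R i unateF).
rewrite -cube_mean_sum; apply: le_trans (cube_mean_le_sqrt _) _.
under eq_cube_mean do rewrite -mulr_suml exprMn sqrr_sign mulr1.
rewrite cube_mean_sqr_linear_form; under eq_bigr do rewrite sqr_cube_sign.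
by rewrite sumr_const card_ord.
Qed.

End AverageSensitivity.

Section LoewnerOrder.
Variables (R : realFieldType) (k : nat).
Implicit Types (M N P : 'M[R]_k).

Lemma psdD M N : psd M -> psd N -> psd (M + N).
Proof.
move=> [symM posM] [symN posN]; split=> [|v].
  move: symM symN; rewrite !is_hermitianmxE !scale1r.
  by rewrite linearD map_mxD => /eqP {1}-> /eqP {1}->.
by rewrite mulmxDr mulmxDl mxE addr_ge0.
Qed.

Lemma loewner_le_trans N M P :
  loewner_le M N -> loewner_le N P -> loewner_le M P.
Proof. by move=> leMN leNP; have := psdD leNP leMN; rewrite addrA subrK. Qed.

End LoewnerOrder.

Lemma loewner_le_sum_flip (R : realFieldType) n k (A : 'I_n -> 'M[R]_k) i
    (x : cube n) :
  psd (cube_sign R x i *: A i) ->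
  loewner_le (\sum_j cube_sign R (cube_flip i x) j *: A j)
             (\sum_j cube_sign R x j *: A j).
Proof.
move=> psdA; rewrite /loewner_le -sumrB (bigD1 i) //=.
rewrite big1 => [|j /negPf neq_ji].
  by rewrite addr0 cube_sign_flip eqxx mulN1r scaleNr opprK; apply: psdD.
by rewrite cube_sign_flip neq_ji mul1r subrr.
Qed.

Section MatrixHalfspace.
Variables (R : realType) (n k : nat) (A : 'I_n -> 'M[R]_k) (s : cube n).
Hypothesis psd_sA : forall i, psd (cube_sign R s i *: A i).

Lemma matrix_halfspace_unate B : unate s (matrix_halfspace A B).
Proof.
move=> i x eq_xs /asboolP le_B; apply/asboolP.
apply: loewner_le_trans le_B; apply: loewner_le_sum_flip.
by rewrite /cube_sign eq_xs; apply: psd_sA.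
Qed.

Lemma avg_sens_matrix_halfspace B :
  avg_sens R (matrix_halfspace A B) <= Num.sqrt n%:R.
Proof. exact/avg_sens_unate/matrix_halfspace_unate. Qed.

End MatrixHalfspace.

Theorem theorem5p2 (R : realType) :
  exists C : R,
    forall (n k : nat) (A1 A2 : 'I_n -> 'M[R]_k) (B1 B2 : 'M[R]_k),
      (forall i, A1 i \is symmetricmx) ->
      (forall i, A2 i \is symmetricmx) ->
      B1 \is symmetricmx ->
      B2 \is symmetricmx ->
      (forall i, loewner_le 0 (A1 i)) ->
      (forall i, loewner_le (A2 i) 0) ->
      avg_sens R (fun x => matrix_halfspace A1 B1 x && matrix_halfspace A2 B2 x)
        <= C * Num.sqrt n%:R.
Proof.
exists 2 => n k A1 A2 B1 B2 _ _ _ _ posA1 negA2.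
apply: le_trans (avg_sens_op2_le _ andb _ _) _; rewrite mulr_natl mulr2n.
apply: lerD.
  apply: (avg_sens_matrix_halfspace (s := [ffun=> false])) => i.
  by have := posA1 i; rewrite /loewner_le subr0 /cube_sign ffunE scale1r.
apply: (avg_sens_matrix_halfspace (s := [ffun=> true])) => i.
by have := negA2 i; rewrite /loewner_le sub0r /cube_sign ffunE expr1 scaleN1r.
Qed.
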